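(* Let $Q_z:\mathbb{C}[x_1,\ldots,x_n]^{S_n}\to\mathbb{C}[x_1,\ldots,x_n]^{S_n}\otimes\mathbb{C}[z]$ be the linear operator defined by $Q_z\bar m_\lambda=q_\lambda(z)\,\bar m_\lambda$ for all partitions $\lambda=(\lambda_1,\ldots,\lambda_n)$, where $q_\lambda(z)=\bar m_\lambda(z,1,\ldots,1)=\frac1n\sum_{j=1}^n z^{\lambda_j}$. Then $Q_z$ admits the following description independent of the basis $\bar m_\lambda$: $$Q_z=\frac1n\sum_{j=1}^n z^{D_j},$$ that is, for every $f\in\mathbb{C}[x_1,\ldots,x_n]^{S_n}$, $$(Q_zf)(x_1,\ldots,x_n)=\frac1n\sum_{j=1}^n f(x_1,\ldots,x_{j-1},zx_j,x_{j+1},\ldots,x_n).$$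
   Context: Partitions of length $n$ are $\lambda=(\lambda_1,\ldots,\lambda_n)\in\mathbb{N}^n$ with $\lambda_1\ge\cdots\ge\lambda_n\ge0$. $\mathbb{C}[x_1,\ldots,x_n]^{S_n}$ is the ring of symmetric polynomials. The monomial symmetric function $m_\lambda(x)$ is the sum of $x_1^{\nu_1}\cdots x_n^{\nu_n}$ over all distinct permutations $\nu$ of $\lambda$; the $m_\lambda$ form a basis of $\mathbb{C}[x_1,\ldots,x_n]^{S_n}$. The normalized version is $\bar m_\lambda(x)=m_\lambda(x)/m_\lambda(1,\ldots,1)=\frac1{n!}\sum_{\sigma\in S_n}x^{\sigma(\lambda)}$ (sum over all permutations), where $x^{a}=x_1^{a_1}\cdots x_n^{a_n}$. $D_j=x_j\,\partial/\partial x_j$, and $z^{D_j}$ is the linear operator acting on monomials by $z^{D_j}x^{a}=z^{a_j}x^{a}$. *)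

(* Defs.v *)
From HB Require Import structures.
From mathcomp Require Import all_boot all_order all_fingroup all_algebra.
From mathcomp Require Import reals complex.
From mathcomp Require Import mpoly.

Set Implicit Arguments.
Unset Strict Implicit.
Unset Printing Implicit Defensive.

Import GRing.Theory.
Local Open Scope ring_scope.

Section SymmetricPolynomials.
Variables (n : nat) (K : comNzRingType).

Record sympoly := SymPoly {
  sympoly_val :> {mpoly K[n]};
  _ : sympoly_val \is symmetric
}.

HB.instance Definition _ := [isSub for sympoly_val].
HB.instance Definition _ := [Choice of sympoly by <:].
HB.instance Definition _ := [SubChoice_isSubComNzRing of sympoly by <:].
HB.instance Definition _ := [SubZmodule_isSubLmodule of sympoly by <:].
HB.instance Definition _ :=
  [SubNzRing_SubLmodule_isSubLalgebra of sympoly by <:].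
HB.instance Definition _ := [SubLalgebra_isSubAlgebra of sympoly by <:].

(* The tensor product of sympoly with K[z] is the ring {poly sympoly} of
   polynomials in z with symmetric coefficients: f (x) z^k is f *: 'X^k. *)
Definition tensz (f : sympoly) (p : {poly K}) : {poly sympoly} :=
  f *: map_poly (in_alg sympoly) p.

Definition is_partition (lam : 'X_{1..n}) : Prop :=
  forall i j : 'I_n, (i <= j)%N -> (lam j <= lam i)%N.

Definition mnm_perm (lam : 'X_{1..n}) (s : 'S_n) : 'X_{1..n} :=
  [multinom lam (s i) | i < n].

Definition mnm_perms (lam : 'X_{1..n}) : seq 'X_{1..n} :=
  undup [seq mnm_perm lam s | s : 'S_n].

Definition monsym_mpoly (lam : 'X_{1..n}) : {mpoly K[n]} :=
  \sum_(nu <- mnm_perms lam) 'X_[nu].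

Lemma monsym_mpoly_sym (lam : 'X_{1..n}) : monsym_mpoly lam \is symmetric.
Proof.
apply/issymP=> s; rewrite /monsym_mpoly raddf_sum /=.
have msX (m : 'X_{1..n}) :
    msym s ('X_[m] : {mpoly K[n]}) = 'X_[mnm_perm m (s^-1)%g].
  apply/mpolyP=> m'; rewrite mcoeff_sym !mcoeffX; congr (nat_of_bool _)%:R.
  apply/eqP/eqP=> [-> | <-]; apply/mnmP=> i; rewrite !mnmE.
    by rewrite permKV.
  by rewrite permK.
rewrite (eq_bigr _ (fun m _ => msX m)) -(big_map (mnm_perm^~ (s^-1)%g) xpredT
  (fun m => 'X_[m])); apply: perm_big; apply: uniq_perm; last move=> m.
- rewrite map_inj_in_uniq ?undup_uniq // => m1 m2 _ _.
  exact: (@mperm_inj n (s^-1)%g).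
- exact: undup_uniq.
- rewrite mem_undup; apply/mapP/mapP=> [[m0]|[t _ ->]].
    rewrite mem_undup => /mapP[t _ ->] ->.
    exists (s^-1 * t)%g; first exact: mem_enum.
    by apply/mnmP=> i; rewrite !mnmE permM.
  exists (mnm_perm lam (s * t)%g).
    by rewrite mem_undup map_f ?mem_enum.
  by apply/mnmP=> i; rewrite !mnmE permM permKV.
Qed.

Definition monsym (lam : 'X_{1..n}) : sympoly := SymPoly (monsym_mpoly_sym lam).

End SymmetricPolynomials.

Section Operators.
Variables (n : nat) (F : fieldType).

Definition monsym_bar (lam : 'X_{1..n}) : sympoly n F :=
  ((monsym F lam : {mpoly F[n]}).@[fun=> 1])^-1 *: monsym F lam.

(* q_lam(z): evaluation at (z, 1, ..., 1), with z the indeterminate of F[z] *)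
Definition qeig (lam : 'X_{1..n}) : {poly F} :=
  mmap polyC (fun i : 'I_n => if i == 0%N :> nat then 'X else 1)
    (monsym_bar lam).

(* Elements of {poly {mpoly F[n]}} are polynomials in z with coefficients in
   F[x_1, ..., x_n]: the outer 'X is z and ('X_i)%:P is the variable x_i. *)
Definition zpowD (j : 'I_n) (f : {mpoly F[n]}) : {poly {mpoly F[n]}} :=
  \sum_(m <- msupp f) (f@_m *: 'X_[m]) *: 'X^(m j).

Definition scale_var (j : 'I_n) (f : {mpoly F[n]}) : {poly {mpoly F[n]}} :=
  mmap (fun c : F => (c%:MP)%:P)
    (fun i : 'I_n => if i == j then 'X * ('X_i)%:P else ('X_i)%:P) f.

End Operators.

(* Linearity of Q over the scalar field F: a scalar c acts on {poly sympoly n F}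
   through the embedding in_alg of F into sympoly n F. *)
Notation zoperator n F :=
  {linear sympoly n F -> {poly sympoly n F} | in_alg (sympoly n F) \; *:%R}.

(* Main.v *)
(* The average of the operators z^(D_j) sends the coefficient of x^m to its
   multiple by (1/n) \sum_j z^(m_j), a factor which is constant on the orbit of
   m.  It therefore preserves symmetry, and \bar m_lam, being supported on the
   orbit of lam, is an eigenvector with eigenvalue q_lam(z).  Symmetrizing f
   writes it as \sum_m f_m \bar m_m, so linearity leaves no other operator. *)
Require Import Defs.
From HB Require Import structures.
From mathcomp Require Import all_boot all_order all_fingroup all_algebra.
From mathcomp Require Import reals complex.
From mathcomp Require Import mpoly.

Set Implicit Arguments.
Unset Strict Implicit.
Unset Printing Implicit Defensive.

Import GRing.Theory.
Local Open Scope ring_scope.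

(** * Exponent vectors and their orbits under permutation *)

Section Orbits.
Variables (n : nat) (F : comNzRingType).
Implicit Types (m lam : 'X_{1..n}) (s t : 'S_n).

Lemma mnm_permM m s t : mnm_perm m (s * t)%g = mnm_perm (mnm_perm m t) s.
Proof. by apply/mnmP=> i; rewrite !mnmE permM. Qed.

Lemma mem_mnm_perms lam m :
  reflect (exists s, m = mnm_perm lam s) (m \in mnm_perms lam).
Proof.
rewrite mem_undup; apply: (iffP mapP) => [[s _ ->]|[s ->]]; exists s => //.
exact: mem_enum.
Qed.

Lemma mcoeff_monsym lam m :
  (monsym_mpoly F lam)@_m = (m \in mnm_perms lam)%:R.
Proof.
rewrite raddf_sum /=; under eq_bigr do rewrite mcoeffX.
rewrite -natr_sum -count_uniq_mem ?undup_uniq // -sum1_count [in RHS]big_mkcond.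
by congr _%:R; apply: eq_bigr => nu _; case: eqP.
Qed.

(* All fibres of s |-> mnm_perm lam s over the orbit of lam are cosets of the
   stabiliser of lam. *)
Lemma sum_mnm_perm lam :
  \sum_(s : 'S_n) 'X_[mnm_perm lam s] =
  #|[set s : 'S_n | mnm_perm lam s == lam]|%:R *: monsym_mpoly F lam.
Proof.
apply/mpolyP=> m; rewrite mcoeffZ mcoeff_monsym raddf_sum /=.
under eq_bigr do rewrite mcoeffX.
case: mem_mnm_perms => [[t ->]|lam'm]; last first.
  rewrite mulr0 big1 // => s _; case: eqP => // lam_m.
  by case: lam'm; exists s.
rewrite mulr1 (reindex_inj (mulgI t)) /= -natr_sum.
rewrite -sum1_card [in RHS]big_mkcond.
congr _%:R; apply: eq_bigr => s _.
by rewrite mnm_permM inE (inj_eq (@mperm_inj n t)); case: eqP.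
Qed.

(* The left-hand side does not depend on i, and summing it over all i makes
   s i run over all of 'I_n for each s. *)
Lemma sum_perm_at (V : nmodType) (G : 'I_n -> V) (i : 'I_n) :
  (\sum_(s : 'S_n) G (s i)) *+ n = (\sum_(j < n) G j) *+ n`!.
Proof.
have indep j : \sum_(s : 'S_n) G (s j) = \sum_(s : 'S_n) G (s i).
  rewrite (reindex_inj (mulgI (tperm i j))) /=.
  by apply: eq_bigr => s _; rewrite permM tpermR.
transitivity (\sum_(j < n) \sum_(s : 'S_n) G (s j)).
  by rewrite (eq_bigr _ (fun j _ => indep j)) sumr_const card_ord.
rewrite exchange_big; transitivity (\sum_(s : 'S_n) \sum_(j < n) G j).
  by apply: eq_bigr => s _; rewrite [RHS](reindex_inj (@perm_inj _ s)).
by rewrite sumr_const card_Sn.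
Qed.

(** Lets a condition on partitions reach every exponent vector: sorting in decreasing order supplies
    the permutation. *)
Lemma mnm_perm_sort m : exists s : 'S_n, is_partition (mnm_perm m s).
Proof.
have /tuple_permP[s def_s] : perm_eq (sort geq m) m by rewrite perm_sort.
have m_nth (i : 'I_n) : m (s i) = nth 0%N (sort geq m) i.
  by rewrite def_s -tnth_nth tnth_mktuple.
have size_s : size (sort geq m) = n by rewrite size_sort size_tuple.
exists s => i j le_ij; rewrite !mnmE !m_nth.
have sorted_s : sorted geq (sort geq m).
  by apply: sort_sorted => a b; apply: leq_total.
have geq_trans : transitive geq by move=> a b c /= ? /leq_trans; apply.
by apply: (sorted_leq_nth geq_trans (leqnn)) => //; rewrite inE size_s.
Qed.

End Orbits.

(** * The averaged operator and its effect on coefficients *)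

Section Operator.
Variables (n : nat) (F : fieldType).
Implicit Types (m lam : 'X_{1..n}) (f : sympoly n F) (p : {mpoly F[n]}).

(** Covers both evaluation at (z, 1, ..., 1) and the power of z released by scaling x_j. *)
Lemma prod_at (A : comNzRingType) (x : A) (e : 'I_n -> nat) (j : 'I_n) :
  \prod_(i < n) (if i == j then x else 1) ^+ e i = x ^+ e j.
Proof.
rewrite (bigD1 j) //= eqxx big1 ?mulr1 // => i /negPf->.
by rewrite expr1n.
Qed.

Lemma scale_varE (j : 'I_n) p : scale_var j p = zpowD j p.
Proof.
apply: eq_bigr => m _; rewrite /mmap1.
(* Each factor splits into its power of z and its power of x_i. *)
rewrite (eq_bigr (fun i => (if i == j then 'X else 1) ^+ m i *
  (('X_i : {mpoly F[n]}) ^+ m i)%:P)) => [|i _]; last first.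
  by case: eqP => _; rewrite ?exprMn ?mul1r ?expr1n ?mul1r polyC_exp.
rewrite big_split /= prod_at -(rmorph_prod polyC) -mpolyXE_id.
by rewrite mulrCA -polyCM mul_mpolyC mulrC mul_polyC.
Qed.

Lemma mcoeff_zpowD (j : 'I_n) p k m :
  ((zpowD j p)`_k)@_m = p@_m * (m j == k)%:R.
Proof.
rewrite coef_sum raddf_sum /= [in RHS](mpolyE p) raddf_sum /= mulr_suml.
apply: eq_bigr => m' _.
rewrite coefZ coefXn mulr_natr mcoeffMn !mcoeffZ mcoeffX -[LHS]mulr_natr.
by have [->|_] := eqVneq m' m; rewrite ?(eq_sym k) // !mulr0 !mul0r.
Qed.

Definition zpowD_avg p : {poly {mpoly F[n]}} :=
  (n%:R^-1)%:MP *: \sum_(j < n) zpowD j p.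

(** The factor multiplying [p@_m] is the coefficient of z^k in (1/n) \sum_j z^(m_j). *)
Lemma mcoeff_zpowD_avg p k m :
  ((zpowD_avg p)`_k)@_m = p@_m * (n%:R^-1 * \sum_(j < n) (m j == k)%:R).
Proof.
rewrite coefZ mcoeffCM coef_sum raddf_sum /= mulrCA; congr (_ * _).
by rewrite mulr_sumr; apply: eq_bigr => j _; rewrite mcoeff_zpowD.
Qed.

Lemma sum_mnm_perm_eq m (s : 'S_n) k :
  \sum_(j < n) (mnm_perm m s j == k)%:R = \sum_(j < n) (m j == k)%:R :> F.
Proof.
rewrite [RHS](reindex_inj (@perm_inj _ s)).
by apply: eq_bigr => j _; rewrite mnmE.
Qed.

Lemma coef_zpowD_avg_sym f k : (zpowD_avg (val f))`_k \is symmetric.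
Proof.
apply/issymP=> s; apply/mpolyP=> m.
rewrite mcoeff_sym !mcoeff_zpowD_avg (sum_mnm_perm_eq m s) -mcoeff_sym.
by have /issymP-> := valP f.
Qed.

(** Every coefficient in z must carry its own proof of symmetry, so the polynomial is rebuilt
    coefficient by coefficient, up to the size of [zpowD_avg]. *)
Definition Qavg f : {poly sympoly n F} :=
  \poly_(k < size (zpowD_avg (val f))) SymPoly (coef_zpowD_avg_sym f k).

Lemma map_val_Qavg f : map_poly \val (Qavg f) = zpowD_avg (val f).
Proof.
apply/polyP=> k; rewrite coef_map coef_poly.
by case: ltnP => // /leq_sizeP->.
Qed.

Lemma mcoeff_Qavg f k m :
  (val (Qavg f)`_k)@_m = (val f)@_m * (n%:R^-1 * \sum_(j < n) (m j == k)%:R).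
Proof. by rewrite -mcoeff_zpowD_avg -map_val_Qavg coef_map. Qed.

(** Each coefficient of [Qavg f] is one of [f] times a factor independent of [f]. *)
Lemma Qavg_linear : linear_for (in_alg (sympoly n F) \; *:%R) Qavg.
Proof.
move=> c f g; apply/polyP=> k; apply/val_inj/mpolyP=> m.
rewrite coefD coefZ mulr_algl raddfD /= linearZ /=.
by rewrite !mcoeff_Qavg linearP /= mulrDl mulrA.
Qed.

HB.instance Definition _ := GRing.isLinear.Build F (sympoly n F)
  {poly sympoly n F} (in_alg (sympoly n F) \; *:%R) Qavg Qavg_linear.

(** * Characteristic zero: division by n and n! *)

Hypothesis charF : [pchar F] =i pred0.

Let natF_neq0 k : (0 < k)%N -> k%:R != 0 :> F.
Proof. by rewrite (pcharf0P _).1 // -lt0n. Qed.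

Let fact_neq0 k : k`!%:R != 0 :> F.
Proof. by rewrite natF_neq0 ?fact_gt0. Qed.

(** Orbit-stabiliser: n! is the order of the stabiliser of [lam] times the orbit size m_lam(1, ...,
    1). *)
Lemma val_monsym_bar lam :
  val (monsym_bar F lam) =
  n`!%:R^-1 *: \sum_(s : 'S_n) 'X_[mnm_perm lam s].
Proof.
rewrite linearZ /= sum_mnm_perm scalerA; congr (_ *: _).
set c : F := #|_|%:R; set M := monsym_mpoly F lam.
(* Both sides are values at (1, ..., 1) of the sum over all permutations. *)
have fact_eq : n`!%:R = c * M.@[fun=> 1].
  rewrite -mevalZ /c /M -sum_mnm_perm raddf_sum /=.
  rewrite (eq_bigr (fun=> 1)) ?sumr_const ?card_Sn // => s _.
  by rewrite mevalX big1 // => i _; rewrite expr1n.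
have c_neq0 : c != 0.
  by apply: contraNneq (fact_neq0 n) => c0; rewrite fact_eq c0 mul0r.
by rewrite fact_eq invfM mulrAC mulVf ?mul1r.
Qed.

(** Only index 0 contributes a power of z, and s(0) takes every value equally often as s varies. *)
Lemma qeigE lam : (0 < n)%N ->
  qeig F lam = n%:R^-1 *: \sum_(j < n) 'X^(lam j).
Proof.
move=> n_gt0; pose i0 := Ordinal n_gt0.
rewrite /qeig [X in mmap _ _ X]val_monsym_bar mmapZ raddf_sum /=.
rewrite (eq_bigr (fun s : 'S_n => 'X^(lam (s i0)))) => [|s _]; last first.
  rewrite mmapX /mmap1 (eq_bigr (fun i => (if i == i0 then 'X else 1)
    ^+ mnm_perm lam s i)) => [|i _]; last by [].
  by rewrite prod_at mnmE.
(* Multiplying by n brings the sum to the division-free form of [sum_perm_at]. *)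
apply: (scalerI (natF_neq0 n_gt0)).
rewrite mul_polyC scalerA mulrC -scalerA scaler_nat.
rewrite (sum_perm_at (fun j => 'X^(lam j))) -scaler_nat !scalerA.
by rewrite mulVf ?divff ?natF_neq0 ?fact_gt0.
Qed.

Lemma monsym_bar_mnm_perm lam (s : 'S_n) :
  monsym_bar F (mnm_perm lam s) = monsym_bar F lam.
Proof.
apply: val_inj; rewrite !val_monsym_bar [in RHS](reindex_inj (mulIg s)) /=.
by congr (_ *: _); apply: eq_bigr => t _; rewrite mnm_permM.
Qed.

Lemma sympolyE f :
  f = \sum_(m <- msupp (val f)) (val f)@_m *: monsym_bar F m.
Proof.
apply: val_inj; rewrite raddf_sum /=.
rewrite (eq_bigr (fun m => n`!%:R^-1 *: ((val f)@_m *: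
  \sum_(s : 'S_n) 'X_[mnm_perm m s]))) => [|m _]; last first.
  rewrite -[X in _ *: X]/(val (monsym_bar F m)) val_monsym_bar.
  by rewrite !scalerA mulrC.
rewrite -scaler_sumr; under eq_bigr do rewrite scaler_sumr.
(* For each fixed s, permuting the exponents of f by s gives back f by symmetry, so the n! equal
   terms cancel the factor 1/n!. *)
rewrite exchange_big /= (eq_bigr (fun=> val f)) => [|s _].
  by rewrite sumr_const card_Sn -scaler_nat scalerA mulVf ?scale1r.
have /issymP/(_ s^-1%g) sym_f := valP f.
rewrite -[RHS]sym_f [in RHS](mpolyE (val f)) raddf_sum /=.
by apply: eq_bigr => m _; rewrite linearZ /= msymX invgK.
Qed.

(** [sympolyE] reduces the claim to a single \bar m_m, which is unchanged when m is sorted into a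
    partition. *)
Lemma zoperator_ext (Q Q' : zoperator n F) :
  (forall lam, is_partition lam ->
     Q (monsym_bar F lam) = Q' (monsym_bar F lam)) -> Q =1 Q'.
Proof.
move=> eqQ f; rewrite [f in LHS]sympolyE [f in RHS]sympolyE !raddf_sum /=.
apply: eq_bigr => m _; rewrite [LHS]linearZ_LR [RHS]linearZ_LR.
by have [s /eqQ] := mnm_perm_sort m; rewrite monsym_bar_mnm_perm => ->.
Qed.

Lemma mcoeff_tensz f (q : {poly F}) k m :
  (val (tensz f q)`_k)@_m = (val f)@_m * q`_k.
Proof. by rewrite coefZ coef_map mulr_algr [val _]linearZ mcoeffZ mulrC. Qed.

Lemma Qavg_monsym_bar lam : (0 < n)%N ->
  Qavg (monsym_bar F lam) = tensz (monsym_bar F lam) (qeig F lam).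
Proof.
move=> n_gt0; apply/polyP=> k; apply/val_inj/mpolyP=> m.
rewrite mcoeff_Qavg mcoeff_tensz [val _]linearZ /= mcoeffZ mcoeff_monsym.
rewrite qeigE // coefZ coef_sum.
under [in RHS]eq_bigr do rewrite coefXn eq_sym.
(* Off the orbit of [lam] both sides vanish; on it the factor for m is the one for [lam]. *)
case: mem_mnm_perms => [[s ->]|_]; last by rewrite mulr0 !mul0r.
by rewrite sum_mnm_perm_eq mulrC.
Qed.

End Operator.

Theorem proposition2p1 (R : realType) (n : nat) (n_gt0 : (0 < n)%N) :
  (forall lam : 'X_{1..n}, is_partition lam ->
     qeig R[i] lam = n%:R^-1 *: \sum_(j < n) 'X^(lam j)) /\
  (exists Q : zoperator n R[i],
     forall lam : 'X_{1..n}, is_partition lam ->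
       Q (monsym_bar R[i] lam) = tensz (monsym_bar R[i] lam) (qeig R[i] lam)) /\
  (forall Q : zoperator n R[i],
     (forall lam : 'X_{1..n}, is_partition lam ->
       Q (monsym_bar R[i] lam) =
         tensz (monsym_bar R[i] lam) (qeig R[i] lam)) ->
     forall f : sympoly n R[i],
       map_poly \val (Q f) =
         (n%:R^-1)%:MP *: \sum_(j < n) zpowD j (\val f) /\
       map_poly \val (Q f) =
         (n%:R^-1)%:MP *: \sum_(j < n) scale_var j (\val f)).
Proof.
have charC : [pchar R[i]] =i pred0 by exact: Num.Theory.pchar_num.
split=> [lam _|]; first exact: qeigE.
split=> [|Q Q_monsym f].
  by exists (@Qavg n R[i]) => lam _; apply: Qavg_monsym_bar.
have QE : map_poly \val (Q f) = zpowD_avg (\val f).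
  (* Uniqueness identifies any such [Q] with [Qavg], whose formula is already known. *)
  rewrite -map_val_Qavg; have -> // : Q f = Qavg f.
  pose Q' : zoperator n R[i] := @Qavg n R[i].
  apply: (@zoperator_ext _ _ charC Q Q') => lam lamP.
  by rewrite Q_monsym //; apply: esym (Qavg_monsym_bar charC lam n_gt0).
by split; rewrite QE //; under [in RHS]eq_bigr do rewrite scale_varE.
Qed.
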